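(* Let $(G,\mu,e,\alpha)$ be a regular Hom-group and let $H$ be a normal Hom-subgroup of $G$. Then $H$ is a maximal Hom-subgroup of $G$ if and only if $G/H$ is a simple Hom-group.
   Context: A Hom-group $(G,\mu,e,\alpha)$ is a set $G$ with an element $e$, a binary operation $\mu$ (written as a product) and a map $\alpha:G\to G$ such that for all $g,h,k\in G$: (1) $\alpha(g)(hk)=(gh)\alpha(k)$; (2) $\alpha(gh)=\alpha(g)\alpha(h)$; (3) $ge=eg=\alpha(g)$ and $\alpha(e)=e$; (4) there is a map $g\mapsto g^{-1}$ with $(gh)^{-1}=h^{-1}g^{-1}$; (5) for every $g$ there is a natural number $k$ with $\alpha^k(gg^{-1})=\alpha^k(g^{-1}g)=e$. It is regular if $\alpha$ is invertible, in which case (5) becomes $gg^{-1}=g^{-1}g=e$. A Hom-subgroup is a nonempty subset $H\subseteq G$ such that $(H,\mu,e,\alpha)$ is a Hom-group; it is normal if $gH=Hg$ for all $g\in G$. For normal $H$, $G/H=\{gH:g\in G\}$ is the Hom-group with product $g_1H\cdot g_2H=(g_1g_2)H$, unit $eH$, twist map $gH\mapsto\alpha(g)H$. A Hom-group is simple if it is nontrivial and has no proper nontrivial normal Hom-subgroups. A Hom-subgroup $H$ of $G$ is maximal if (1) $H$ is normal in $G$, and (2) if $K$ is a normal Hom-subgroup of $G$ with $H\le K$, then $K=H$ or $K=G$; i.e. the only normal Hom-subgroup of $G$ which contains $H$ as a proper Hom-subgroup is $G$. *)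

(* Defs.v *)
From mathcomp Require Import ssreflect ssrfun ssrbool ssrnat.
From mathcomp Require Import classical_sets.

Set Implicit Arguments.
Unset Strict Implicit.
Unset Printing Implicit Defensive.

Local Open Scope classical_set_scope.

(* [is_hom_group A mu e alpha]: the subset [A] of [T] is a Hom-group for the
   restrictions of [mu] and [alpha], with unit [e].  The inverse map is not part
   of the data; only its values on [A] matter. *)
Record is_hom_group (T : Type) (A : set T) (mu : T -> T -> T) (e : T)
    (alpha : T -> T) : Prop := IsHomGroup {
  hg_unit_in : A e;
  hg_mul_in : forall g h, A g -> A h -> A (mu g h);
  hg_twist_in : forall g, A g -> A (alpha g);
  hg_assoc : forall g h k, A g -> A h -> A k ->
    mu (alpha g) (mu h k) = mu (mu g h) (alpha k);
  hg_twistM : forall g h, A g -> A h -> alpha (mu g h) = mu (alpha g) (alpha h);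
  hg_mule : forall g, A g -> mu g e = alpha g;
  hg_emul : forall g, A g -> mu e g = alpha g;
  hg_twist_unit : alpha e = e;
  hg_inv : exists inv : T -> T,
    [/\ forall g, A g -> A (inv g),
        forall g h, A g -> A h -> inv (mu g h) = mu (inv h) (inv g) &
        forall g, A g -> exists k : nat,
          iter k alpha (mu g (inv g)) = e /\ iter k alpha (mu (inv g) g) = e] }.

Record homGroup := HomGroup {
  hg_sort :> Type;
  hmul : hg_sort -> hg_sort -> hg_sort;
  hone : hg_sort;
  htwist : hg_sort -> hg_sort;
  hg_axioms : is_hom_group setT hmul hone htwist }.

Arguments hone {h}.

Definition regular (G : homGroup) : Prop := bijective (@htwist G).

(* The twist need not map a Hom-subgroup onto itself, even when it is
   invertible on the ambient Hom-group. *)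
Definition hom_subgroup (G : homGroup) (H : set G) : Prop :=
  H !=set0 /\ is_hom_group H (@hmul G) hone (@htwist G).

Definition lcoset (G : homGroup) (g : G) (H : set G) : set G :=
  [set hmul g h | h in H].

Definition rcoset (G : homGroup) (H : set G) (g : G) : set G :=
  [set hmul h g | h in H].

Definition normal_hom_subgroup (G : homGroup) (H : set G) : Prop :=
  hom_subgroup H /\ forall g : G, lcoset g H = rcoset H g.

(* [G] itself is not maximal: [G] has to be the only normal Hom-subgroup
   properly containing [H], so it does contain [H] properly. *)
Definition maximal_hom_subgroup (G : homGroup) (H : set G) : Prop :=
  [/\ normal_hom_subgroup H,
      H <> setT &
      forall K : set G, normal_hom_subgroup K -> H `<=` K ->
        K = H \/ K = setT].

Definition simple_hom_group (G : homGroup) : Prop :=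
  [set: G] <> [set hone] /\
  forall N : set G, normal_hom_subgroup N -> N = [set hone] \/ N = setT.

Definition cosets (G : homGroup) (H : set G) : Type :=
  {C : set G | exists g : G, C = lcoset g H}.

Definition to_coset (G : homGroup) (H : set G) (g : G) : cosets H :=
  exist _ (lcoset g H) (ex_intro _ g erefl).

(* These equations determine [mu] and [alpha], every coset being some
   [to_coset H g]; they can be satisfied exactly when the product and the twist
   of cosets do not depend on the representatives.  That can fail for a normal
   [H] with [alpha H] strictly contained in [H], hence a predicate. *)
Definition coset_operations (G : homGroup) (H : set G)
    (mu : cosets H -> cosets H -> cosets H) (alpha : cosets H -> cosets H) :
    Prop :=
  (forall g1 g2 : G,
     mu (to_coset H g1) (to_coset H g2) = to_coset H (hmul g1 g2)) /\
  (forall g : G, alpha (to_coset H g) = to_coset H (htwist g)).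

(* [G/H], with the operations induced by representatives, is a simple
   Hom-group. *)
Definition quotient_is_simple (G : homGroup) (H : set G) : Prop :=
  exists (mu : cosets H -> cosets H -> cosets H) (alpha : cosets H -> cosets H)
         (ax : is_hom_group setT mu (to_coset H hone) alpha),
    coset_operations mu alpha /\ simple_hom_group (HomGroup ax).

(* Main.v *)
Require Import Defs.
From mathcomp Require Import ssreflect ssrfun ssrbool ssrnat.
From mathcomp Require Import boolp classical_sets.

(** Write [a] for the twist of a regular Hom-group [G].  Since [a] is
    invertible, [x * y := a^-1 (x y)] makes [G] a group of which [a] is an
    automorphism, and the Hom-product is recovered as [x y = a (x * y)].  In
    these terms a normal Hom-subgroup is a conjugation-invariant subset [K]
    containing the unit, closed under inverses and such that [a (K * K)] lies
    in [K] ([normal_hom_subgroupE]).  Such a [K] need not be a subgroup: in the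
    additive group of the dyadic rationals with twist [x |-> 2 x], the even
    integers together with [1] and [-1] satisfy these conditions but are not
    closed under addition.  So the cosets of [H] need not partition [G], and
    the quotient operations need not be well defined.  Maximality has to provide
    them; conversely, a simple quotient has to be exploited without knowing that
    [H] is a subgroup.

    If [H] is maximal, then [a^-1 (H)] is a normal Hom-subgroup containing [H],
    and it is not [G] because [H] is not; hence [a^-1 (H) = H]
    ([maximal_twist_stable]).  It follows that [H] is a genuine normal subgroup
    with [a (H) = H], that the quotient operations exist, and that normal
    Hom-subgroups of [G/H] pull back to normal Hom-subgroups of [G] containing
    [H] ([preimage_normal]), where maximality applies.

    Conversely, whenever quotient operations exist, a normal Hom-subgroup [K]
    of [G] has a normal image in [G/H] ([image_normal]).  If [G/H] is simple and
    [K] contains [H], this image is trivial or full.  In the first case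
    [a k = k e] lies in [k H = e H = a (H)] for all [k] in [K], so [K = H].  In
    the second every [a g = g e] lies in [g H = k H] for some [k] in [K], hence
    in [K], and [K = G] because [a] is onto. *)

Set Implicit Arguments.
Unset Strict Implicit.
Unset Printing Implicit Defensive.

Local Open Scope classical_set_scope.

(** * The group underlying a regular Hom-group *)

Record untwisting (G : homGroup) := Untwisting {
  umul : G -> G -> G;
  uinv : G -> G;
  untwist : G -> G;
  htwistK : cancel (@htwist G) untwist;
  untwistK : cancel untwist (@htwist G);
  hmulE : forall x y, hmul x y = htwist (umul x y);
  umulA : associative umul;
  umul1g : left_id hone umul;
  umulg1 : right_id hone umul;
  umulVg : left_inverse hone uinv umul;
  umulgV : right_inverse hone uinv umul;
  htwistM : {morph @htwist G : x y / umul x y} }.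

Lemma iter_htwist1 (G : homGroup) k : iter k (@htwist G) hone = hone.
Proof. by elim: k => //= k ->; rewrite (hg_twist_unit (hg_axioms G)). Qed.

Lemma regular_untwisting (G : homGroup) : regular G -> inhabited (untwisting G).
Proof.
case: (hg_axioms G) => _ _ _ hA hM h1 h1' a1 [inv [_ _ invP]] [b abK baK].
have aM x y : htwist (hmul x y) = hmul (htwist x) (htwist y) :> G by exact: hM.
have b1 : b hone = hone by rewrite -[in LHS]a1 abK.
(* Injectivity of the twist cancels the exponent in the inverse axiom. *)
have itI k x : iter k (@htwist G) x = hone -> x = hone.
  elim: k => //= k IH akx; apply: IH; apply: (can_inj abK).
  by rewrite a1.
have invr x : hmul x (inv x) = hone by have [k [+ _]] := invP x I; apply: itI.
have invl x : hmul (inv x) x = hone by have [k [_ +]] := invP x I; apply: itI.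
constructor; apply: (@Untwisting G (fun x y => b (hmul x y)) inv b) => //.
- move=> x y z; congr b; apply: (can_inj abK).
  by rewrite (aM x) (aM _ z) !baK; apply: hA.
- by move=> x; rewrite h1' ?abK.
- by move=> x; rewrite h1 ?abK.
- by move=> x; rewrite invl.
- by move=> x; rewrite invr.
- by move=> x y; rewrite baK -aM abK.
Qed.

Section Untwisted.
Variables (G : homGroup) (U : untwisting G).
Local Notation "x * y" := (umul U x y).
Local Notation "x ^-1" := (uinv U x).
Local Notation a := (@htwist G).

Let mulA x y z : x * (y * z) = x * y * z. Proof. exact: umulA. Qed.
Let mul1g x : hone * x = x. Proof. exact: umul1g. Qed.
Let mulg1 x : x * hone = x. Proof. exact: umulg1. Qed.
Let mulVg x : x^-1 * x = hone. Proof. exact: umulVg. Qed.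
Let mulgV x : x * x^-1 = hone. Proof. exact: umulgV. Qed.
Let aM x y : a (x * y) = a x * a y. Proof. exact: htwistM. Qed.

Lemma htwist_inj : injective a.
Proof. exact: can_inj (htwistK U). Qed.

Lemma iter_htwist_inj k : injective (iter k a).
Proof. by elim: k => //= k IH x y /htwist_inj/IH. Qed.

Lemma umulK x y : x * y * y^-1 = x.
Proof. by rewrite -mulA mulgV mulg1. Qed.

Lemma umulVK x y : x * y^-1 * y = x.
Proof. by rewrite -mulA mulVg mulg1. Qed.

Lemma uinv_uniq x y : x * y = hone -> y = x^-1.
Proof. by move=> xy1; rewrite -[y]mul1g -(mulVg x) -mulA xy1 mulg1. Qed.

Lemma uinvK x : x^-1^-1 = x.
Proof. by apply/esym/uinv_uniq; rewrite mulVg. Qed.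

Lemma uinvM x y : (x * y)^-1 = y^-1 * x^-1.
Proof. by apply/esym/uinv_uniq; rewrite mulA umulK mulgV. Qed.

Lemma htwist1 : a hone = hone.
Proof. exact: (iter_htwist1 G 1). Qed.

Lemma htwistV x : a x^-1 = (a x)^-1.
Proof. by apply: uinv_uniq; rewrite -aM mulgV htwist1. Qed.

Lemma hmulg1 (x : G) : hmul x hone = a x.
Proof. by rewrite (hmulE U) mulg1. Qed.

Lemma hmul1g (x : G) : hmul hone x = a x.
Proof. by rewrite (hmulE U) mul1g. Qed.

(** * Normal Hom-subgroups in terms of the group law *)

Lemma hom_subgroupE (K : set G) : hom_subgroup K <->
  [/\ K hone, forall x y, K x -> K y -> K (a (x * y)) &
      forall x, K x -> K x^-1].
Proof.
split=> [[_ [K1 KM _ _ _ _ _ _ [inv [Kinv _ invP]]]]|[K1 KM KV]].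
  split=> // [x y Kx Ky|x Kx]; first by rewrite -(hmulE U); apply: KM.
  have [k [xV _]] := invP x Kx.
  suff <- : inv x = x^-1 by apply: Kinv.
  apply/uinv_uniq/(@iter_htwist_inj k.+1).
  by rewrite iterSr -(hmulE U) xV iter_htwist1.
case: (hg_axioms G) => _ _ _ hA hM h1 h1' a1 _.
split; first by exists hone.
split=> // [x y Kx Ky|x Kx|x y z _ _ _|x y _ _|x _|x _|].
- by rewrite (hmulE U); apply: KM.
- by rewrite -[x]mulg1; apply: KM.
- exact: hA.
- exact: hM.
- exact: h1.
- exact: h1'.
exists (uinv U); split=> // [x y _ _|x _].
  by rewrite !(hmulE U) -htwistV uinvM.
by exists 0; rewrite /= !(hmulE U) mulgV mulVg htwist1.
Qed.

Lemma normal_hom_subgroupE (K : set G) : normal_hom_subgroup K <->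
  [/\ K hone, forall x y, K x -> K y -> K (a (x * y)),
      forall x, K x -> K x^-1 & forall g x, K x -> K (g * x * g^-1)].
Proof.
split=> [[/hom_subgroupE[K1 KM KV] Kn]|[K1 KM KV KJ]].
  split=> // g x Kx; have : lcoset g K (hmul g x) by exists x.
  rewrite Kn => -[y Ky]; rewrite !(hmulE U) => /htwist_inj <-.
  by rewrite umulK.
split; first exact/hom_subgroupE.
move=> g; apply/seteqP; split=> _ [x Kx <-].
  by exists (g * x * g^-1); [exact: KJ | rewrite !(hmulE U) umulVK].
exists (g^-1 * x * g); first by rewrite -{2}[g]uinvK; apply: KJ.
by rewrite !(hmulE U) !mulA mulgV mul1g.
Qed.

(** * Cosets and maps out of the set of cosets *)

Lemma to_coset_eq (H : set G) g g' :
  (to_coset H g = to_coset H g') <-> (lcoset g H = lcoset g' H).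
Proof. by split=> [/(congr1 sval)//|e]; apply: eq_exist. Qed.

Lemma to_coset_surj (H : set G) (C : cosets H) : exists g, C = to_coset H g.
Proof. by case: C => C [g Cg]; exists g; apply: eq_exist. Qed.

Lemma lift_cosets (X : Type) (H : set G) (F : G -> X) :
    (forall g g', lcoset g H = lcoset g' H -> F g = F g') ->
  exists f : cosets H -> X, forall g, f (to_coset H g) = F g.
Proof.
move=> FP; exists (fun C => F (sval (cid (to_coset_surj C)))) => g.
by case: cid => g' /= /to_coset_eq e; apply: FP.
Qed.

(** The inverses of the elements of [g H] form the right coset of [g^-1].
    Normality turns it into a left coset again, so inversion is well defined on
    cosets even when they do not partition [G]. *)
Lemma uinv_lcoset (H : set G) g : normal_hom_subgroup H ->
  uinv U @` lcoset g H = lcoset (g^-1) H.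
Proof.
move=> nH; have /normal_hom_subgroupE[_ _ HV _] := nH.
rewrite (proj2 nH g^-1); apply/seteqP; split.
  move=> _ [_ [h Hh <-] <-]; exists (h^-1); first exact: HV.
  by rewrite !(hmulE U) -htwistV uinvM.
move=> _ [h Hh <-]; exists (hmul g (h^-1));
  first (by exists (h^-1) => //; exact: HV).
by rewrite !(hmulE U) -htwistV uinvM uinvK.
Qed.

(** * Quotient operations *)

Section Quotient.
Variables (H : set G) (nH : normal_hom_subgroup H).
Variables (mu : cosets H -> cosets H -> cosets H) (al : cosets H -> cosets H).
Hypothesis ops : coset_operations mu al.

Lemma coset_mul x y : mu (to_coset H x) (to_coset H y) = to_coset H (hmul x y).
Proof. exact: (proj1 ops). Qed.

Lemma coset_twist x : al (to_coset H x) = to_coset H (a x).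
Proof. exact: (proj2 ops). Qed.

Lemma coset_iter_twist k x :
  iter k al (to_coset H x) = to_coset H (iter k a x).
Proof. by elim: k => //= k ->; rewrite coset_twist. Qed.

(** Every axiom holds in the image because it holds for representatives; only
    the inverse map has to be shown to descend to cosets. *)
Lemma image_hom_group (K : set G) : hom_subgroup K ->
  is_hom_group (to_coset H @` K) mu (to_coset H hone) al.
Proof.
move=> sK; have /hom_subgroupE[K1 KM KV] := sK.
case: sK => _ [_ _ Ka hA hM h1 h1' a1 _].
have [inv invE] : exists inv, forall g, inv (to_coset H g) = to_coset H g^-1.
  by apply: lift_cosets => g g' e; apply/to_coset_eq; rewrite -!uinv_lcoset ?e.
split.
- by exists hone.
- move=> _ _ [x Kx <-] [y Ky <-]; rewrite coset_mul (hmulE U).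
  by exists (a (x * y)) => //; apply: KM.
- by move=> _ [x Kx <-]; rewrite coset_twist; exists (a x) => //; apply: Ka.
- move=> _ _ _ [x Kx <-] [y Ky <-] [z Kz <-].
  by rewrite !(coset_twist, coset_mul) hA.
- by move=> _ _ [x Kx <-] [y Ky <-]; rewrite !(coset_twist, coset_mul) hM.
- by move=> _ [x Kx <-]; rewrite coset_mul coset_twist h1.
- by move=> _ [x Kx <-]; rewrite coset_mul coset_twist h1'.
- by rewrite coset_twist a1.
exists inv; split.
- by move=> _ [x Kx <-]; rewrite invE; exists x^-1 => //; apply: KV.
- move=> _ _ [x Kx <-] [y Ky <-].
  by rewrite !(coset_mul, invE) !(hmulE U) -htwistV uinvM.
- move=> _ [x Kx <-]; exists 0.
  by rewrite /= invE !coset_mul !(hmulE U) mulgV mulVg htwist1.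
Qed.

Variable ax : is_hom_group setT mu (to_coset H hone) al.
Local Notation Q := (HomGroup ax).

Lemma image_normal (K : set G) : normal_hom_subgroup K ->
  normal_hom_subgroup (to_coset H @` K : set Q).
Proof.
case=> sK Kn; split.
  split; last exact: image_hom_group.
  by have /hom_subgroupE[K1 _ _] := sK; exists (to_coset H hone), hone.
move=> C; have [g ->] := to_coset_surj C.
apply/seteqP; split=> _ [_ [x Kx <-] <-] /=; rewrite coset_mul.
  have : lcoset g K (hmul g x) by exists x.
  rewrite Kn => -[y Ky <-]; exists (to_coset H y); first by exists y.
  exact: coset_mul.
have : rcoset K g (hmul x g) by exists x.
rewrite -Kn => -[y Ky <-]; exists (to_coset H y); first by exists y.
exact: coset_mul.
Qed.

(** If the image of [K] is trivial, then [a k = k e] lies in [e H = a (H)] for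
    all [k] in [K]; if it is everything, then every [a g = g e] lies in some
    [k H] with [k] in [K], hence in [K]. *)
Lemma simple_quotient_maximal : simple_hom_group Q -> maximal_hom_subgroup H.
Proof.
move=> [Q1 Qn]; have /normal_hom_subgroupE[H1 _ _ _] := nH.
split=> // [HT|K nK HK].
  have lT g : lcoset g H = setT.
    apply/seteqP; split=> // x _; exists (g^-1 * untwist U x).
      by rewrite HT.
    by rewrite (hmulE U) mulA mulgV mul1g untwistK.
  apply: Q1; apply/seteqP; split=> //= C _; have [g ->] := to_coset_surj C.
  by apply/to_coset_eq; rewrite !lT.
have /normal_hom_subgroupE[K1 KM _ _] := nK.
have coset_unit g : lcoset g H (a g) by exists hone => //; rewrite hmulg1.
have [im1|imT] := Qn _ (image_normal nK).
  left; apply/seteqP; split=> // k Kk.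
  have : (to_coset H @` K) (to_coset H k) by exists k.
  rewrite im1 /= => /to_coset_eq kH; have := coset_unit k.
  by rewrite kH => -[h Hh]; rewrite hmul1g => /htwist_inj <-.
right; apply/seteqP; split=> // g _.
have [k Kk /to_coset_eq kg] : (to_coset H @` K) (to_coset H (untwist U g)).
  by rewrite imT.
have := coset_unit (untwist U g); rewrite -kg untwistK => -[h Hh <-].
by rewrite (hmulE U); apply: KM => //; apply: HK.
Qed.
End Quotient.

(** * Maximal Hom-subgroups *)

(** [a^-1 (H)] is again a normal Hom-subgroup because [a] is an automorphism; it
    contains [H], and it is proper because [a] is onto. *)
Lemma maximal_twist_stable (H : set G) x :
  maximal_hom_subgroup H -> H (a x) -> H x.
Proof.
move=> [nH HT Hmax] Hax; have /normal_hom_subgroupE[H1 HM HV HJ] := nH.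
have Ha y : H y -> H (a y) by move=> Hy; rewrite -[y]mulg1; apply: HM.
have nK : normal_hom_subgroup (a @^-1` H).
  apply/normal_hom_subgroupE; split=> /= [|y z Hy Hz|y Hy|g y Hy].
  - by rewrite htwist1.
  - by rewrite aM; apply: HM.
  - by rewrite htwistV; apply: HV.
  - by rewrite !aM htwistV; apply: HJ.
have [KH|KT] := Hmax _ nK Ha; first by rewrite -KH.
case: HT; apply/seteqP; split=> // y _.
have : (a @^-1` H) (untwist U y) by rewrite KT.
by rewrite /= untwistK.
Qed.

Section Maximal.
Variables (H : set G) (mH : maximal_hom_subgroup H).

Let nH : normal_hom_subgroup H. Proof. by case: mH. Qed.
Let H1 : H hone. Proof. by have /normal_hom_subgroupE[] := nH. Qed.
Let HV x : H x -> H x^-1.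
Proof. by have /normal_hom_subgroupE[_ _ V _] := nH; apply: V. Qed.
Let HJ g x : H x -> H (g * x * g^-1).
Proof. by have /normal_hom_subgroupE[_ _ _ J] := nH; apply: J. Qed.
Let HM x y : H x -> H y -> H (x * y).
Proof.
have /normal_hom_subgroupE[_ M _ _] := nH.
by move=> Hx Hy; apply: maximal_twist_stable => //; apply: M.
Qed.
Let Ha x : H x -> H (a x).
Proof.
have /normal_hom_subgroupE[_ M _ _] := nH.
by move=> Hx; rewrite -[x]mulg1; apply: M.
Qed.

Lemma maximal_coset_eq g g' :
  to_coset H g = to_coset H g' <-> H (g^-1 * g').
Proof.
rewrite to_coset_eq; split=> [gg'|Hgg'].
  have : lcoset g' H (a g') by exists hone => //; rewrite hmulg1.
  rewrite -gg' => -[h Hh]; rewrite (hmulE U) => /htwist_inj <-.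
  by rewrite mulA mulVg mul1g.
apply/seteqP; split=> _ [h Hh <-].
  exists ((g^-1 * g')^-1 * h); first by apply: HM => //; apply: HV.
  by rewrite !(hmulE U) uinvM uinvK !mulA mulgV mul1g.
exists (g^-1 * g' * h); first exact: HM.
by rewrite !(hmulE U) !mulA mulgV mul1g.
Qed.

Lemma maximal_coset_operations :
  exists (mu : cosets H -> cosets H -> cosets H) (al : cosets H -> cosets H),
    coset_operations mu al.
Proof.
have [al alE] : exists al, forall g, al (to_coset H g) = to_coset H (a g).
  apply: lift_cosets => g g' /to_coset_eq/maximal_coset_eq Hgg'.
  by apply/maximal_coset_eq; rewrite -htwistV -aM; apply: Ha.
(* Descend in the second argument first, for each fixed representative of the
   first one. *)
have [mur murE] : exists mur : G -> cosets H -> cosets H,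
    forall g g', mur g (to_coset H g') = to_coset H (hmul g g').
  suff /choice[f fE] : forall g, exists f : cosets H -> cosets H,
      forall g', f (to_coset H g') = to_coset H (hmul g g') by exists f.
  move=> g; apply: lift_cosets => x y /to_coset_eq/maximal_coset_eq Hxy.
  apply/maximal_coset_eq; rewrite !(hmulE U) -htwistV -aM; apply: Ha.
  by rewrite uinvM mulA umulVK.
have [mu muE] : exists mu, forall g, mu (to_coset H g) = mur g.
  apply: lift_cosets => x y /to_coset_eq/maximal_coset_eq Hxy.
  apply: funext => C; have [g ->] := to_coset_surj C.
  rewrite !murE; apply/maximal_coset_eq.
  rewrite !(hmulE U) -htwistV -aM; apply: Ha.
  by rewrite uinvM mulA -[_ * _ * y]mulA -{2}[g](uinvK g); apply: HJ.
by exists mu, al; split=> // g g'; rewrite muE murE.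
Qed.

Variables (mu : cosets H -> cosets H -> cosets H) (al : cosets H -> cosets H).
Hypothesis ops : coset_operations mu al.
Variable ax : is_hom_group setT mu (to_coset H hone) al.
Local Notation Q := (HomGroup ax).

Lemma preimage_normal (N : set Q) :
  normal_hom_subgroup N -> normal_hom_subgroup (to_coset H @^-1` N).
Proof.
move=> [[_ [N1 NM _ _ _ _ _ _ [inv [Ninv _ invP]]]] Nn].
have cM := coset_mul ops.
apply/normal_hom_subgroupE; split=> /= [|x y Nx Ny|x Nx|g x Nx].
- exact: N1.
- by rewrite -(hmulE U) -cM; apply: NM.
- (* The inverse map that makes [N] a Hom-group is only known up to a power of
     the twist, which acts injectively on the cosets of [H]. *)
  have [y yE] := to_coset_surj (inv (to_coset H x)).
  have [k [+ _]] := invP _ Nx.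
  rewrite yE /= cM (coset_iter_twist ops) => /esym/maximal_coset_eq.
  have -> : hone^-1 = hone by rewrite -[LHS]mulg1 mulVg.
  rewrite mul1g (hmulE U) -iterSr => Hxy.
  suff Hxy1 : H (x * y).
    suff -> : to_coset H x^-1 = to_coset H y by rewrite -yE; apply: Ninv.
    by apply/maximal_coset_eq; rewrite uinvK.
  by elim: (k.+1) Hxy => //= n IH /(maximal_twist_stable mH).
have : lcoset (to_coset H g : Q) N (to_coset H (hmul g x)).
  by exists (to_coset H x); rewrite //= cM.
rewrite Nn => -[C NC]; have [y yE] := to_coset_surj C; rewrite {}yE in NC *.
rewrite /= cM !(hmulE U) => /maximal_coset_eq.
rewrite -htwistV -aM => /(maximal_twist_stable mH) Hyx.
suff -> : to_coset H (g * x * g^-1) = to_coset H y by [].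
apply/esym/maximal_coset_eq; have := HJ g Hyx.
by rewrite uinvM !mulA mulgV mul1g.
Qed.

Lemma maximal_quotient_simple : simple_hom_group Q.
Proof.
have [_ HT Hmax] := mH.
have coset1 g : to_coset H g = to_coset H hone <-> H g.
  split=> [/maximal_coset_eq/HV|Hg]; first by rewrite mulg1 uinvK.
  by apply/maximal_coset_eq; rewrite mulg1; apply: HV.
split=> [Q1|N nN].
  apply: HT; apply/seteqP; split=> // g _; apply/coset1.
  by have : [set: Q] (to_coset H g) by []; rewrite Q1.
have N1 : N (to_coset H hone) by case: nN => -[_ []].
have HN : H `<=` to_coset H @^-1` N by move=> h /coset1 /= ->.
have [NH|NT] := Hmax _ (preimage_normal nN) HN; [left|right].
  apply/seteqP; split=> [C NC|_ -> //].
  have [g gE] := to_coset_surj C; rewrite {}gE in NC *.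
  by apply/coset1; rewrite -NH.
apply/seteqP; split=> // C _; have [g ->] := to_coset_surj C.
by have : (to_coset H @^-1` N) g by rewrite NT.
Qed.
End Maximal.
End Untwisted.

Theorem proposition4p4 (G : homGroup) (H : set G) (regG : regular G)
    (nH : normal_hom_subgroup H) :
  maximal_hom_subgroup H <-> quotient_is_simple H.
Proof.
have [U] := regular_untwisting regG.
split=> [mH|[mu [al [ax [ops sQ]]]]]; last first.
  exact: (simple_quotient_maximal U nH ops sQ).
have [mu [al ops]] := maximal_coset_operations U mH.
have sG : hom_subgroup [set: G] by split; [exists hone | exact: hg_axioms].
have ax : is_hom_group setT mu (to_coset H hone) al.
  suff <- : to_coset H @` setT = setT by apply: (image_hom_group U nH ops sG).
  apply/seteqP; split=> // C _; have [g ->] := to_coset_surj C.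
  by exists g.
by exists mu, al, ax; split=> //; apply: (maximal_quotient_simple U mH ops).
Qed.
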